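(* Let $E$ be either a Euclidean space $\mathbb{R}^d$ or a separable Hilbert space, with norm $\|\cdot\|$. Let $X, X', Y, Y'$ be random vectors with values in $E$ and let $\varepsilon, \delta$ be real random variables such that $X, X', Y, Y', \varepsilon, \delta$ are mutually independent, $X' \stackrel{d}{=} X$, $Y' \stackrel{d}{=} Y$, and each of $\varepsilon$ and $\delta$ takes the values $0$ and $1$ with probability $1/2$ each. Define the real random variable $$S = \delta\,\|X-Y\| - (1-\delta)\Bigl(\varepsilon\,\|X-X'\| + (1-\varepsilon)\,\|Y-Y'\|\Bigr).$$ Then $X \stackrel{d}{=} Y$ if and only if the distribution of $S$ is symmetric around the origin, i.e. $S \stackrel{d}{=} -S$.
   Context: The symbol $\stackrel{d}{=}$ denotes equality in distribution. Random vectors in $E$ are Borel measurable. *)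

(* Defs.v *)
From HB Require Import structures.
From mathcomp Require Import all_boot all_order all_algebra.
From mathcomp Require Import all_classical all_reals all_analysis.
From mathcomp Require Import lra ring.

Set Implicit Arguments.
Unset Strict Implicit.
Unset Printing Implicit Defensive.

Import Order.TTheory GRing.Theory Num.Theory.
Import numFieldNormedType.Exports.

Local Open Scope classical_set_scope.
Local Open Scope ring_scope.

(* Real Hilbert spaces: the norm of a complete normed module comes from an inner
   product. *)
HB.mixin Record CompleteNormedModule_isHilbert (R : realType) E
    & CompleteNormedModule R E := {
  inner : {dot E for (@idfun R)} ;
  sqr_normE : forall x : E, `|x| ^+ 2 = inner x x
}.

#[short(type="hilbertType")]
HB.structure Definition Hilbert (R : realType) :=
  {E of CompleteNormedModule R E & CompleteNormedModule_isHilbert R E}.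

Definition separable (E : topologicalType) : Prop :=
  exists2 D : set E, countable D & dense D.

(* R^d with the Euclidean norm; a fresh name is needed because 'rV[R]_d already
   carries the sup norm. The instances and the lemma below make it a separable
   Hilbert space. *)
Definition euclidean (R : realType) (d : nat) : Type := 'rV[R]_d.

Section euclidean.
Variables (R : realType) (d : nat).
Local Notation E := (euclidean R d).

HB.instance Definition _ := GRing.Lmodule.on E.

Definition euclidean_inner (x y : E) : R := \sum_i x ord0 i * y ord0 i.

Let innerC x y : euclidean_inner x y = euclidean_inner y x.
Proof. by apply: eq_bigr => i _; rewrite mulrC. Qed.

Let innerZ (a : R) x y : euclidean_inner (a *: x) y = a * euclidean_inner x y.
Proof. by rewrite mulr_sumr; apply: eq_bigr => i _; rewrite mxE mulrA. Qed.

Let innerD x y z :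
  euclidean_inner (x + y) z = euclidean_inner x z + euclidean_inner y z.
Proof. by rewrite -big_split; apply: eq_bigr => i _; rewrite mxE mulrDl. Qed.

Let inner_ge0 x : 0 <= euclidean_inner x x.
Proof. by apply: sumr_ge0 => i _; rewrite -expr2 sqr_ge0. Qed.

Let inner_eq0 x : euclidean_inner x x = 0 -> x = 0.
Proof.
move=> /eqP; rewrite psumr_eq0; last by move=> i _; rewrite -expr2 sqr_ge0.
move=> /allP h; apply/rowP => i; rewrite mxE.
by have := h i (mem_index_enum _); rewrite /= mulf_eq0 orbb => /eqP.
Qed.

Let CauchySchwarz x y :
  euclidean_inner x y ^+ 2 <= euclidean_inner x x * euclidean_inner y y.
Proof.
set a := euclidean_inner x x; set b := euclidean_inner x y.
set c := euclidean_inner y y.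
have [/inner_eq0 y0|c0] := eqVneq c 0.
  have -> : b = 0.
    by rewrite /b y0; apply: big1 => i _; rewrite mxE mulr0.
  by rewrite expr0n /= mulr_ge0 // inner_ge0.
have cp : 0 < c by rewrite lt_neqAle eq_sym c0 inner_ge0.
have := inner_ge0 (c *: x + (- b) *: y).
rewrite innerD !innerZ [euclidean_inner x (_ + _)]innerC.
rewrite [euclidean_inner y (_ + _)]innerC !innerD !innerZ.
rewrite [euclidean_inner y x]innerC -/a -/b -/c.
have -> : c * (c * a + - b * b) + - b * (c * b + - b * c) =
  c * (a * c - b ^+ 2) by ring.
by rewrite pmulr_rge0// subr_ge0.
Qed.

Definition euclidean_norm (x : E) : R := Num.sqrt (euclidean_inner x x).

Let ler_normD (x y : E) :
  euclidean_norm (x + y) <= euclidean_norm x + euclidean_norm y.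
Proof.
have h : 0 <= euclidean_norm x + euclidean_norm y
  by rewrite addr_ge0 ?sqrtr_ge0.
rewrite -(ger0_norm h) -sqrtr_sqr ler_wsqrtr// sqrrD !sqr_sqrtr ?inner_ge0//.
rewrite innerD ![euclidean_inner _ (x + y)]innerC !innerD.
rewrite [euclidean_inner y x]innerC.
suff : euclidean_inner x y <= euclidean_norm x * euclidean_norm y by lra.
rewrite -sqrtrM ?inner_ge0// (le_trans (ler_norm _))//.
by rewrite -sqrtr_sqr ler_wsqrtr.
Qed.

Let normrZ (a : R) (x : E) : euclidean_norm (a *: x) = `|a| * euclidean_norm x.
Proof.
rewrite /euclidean_norm innerZ innerC innerZ mulrA -expr2 sqrtrM ?sqr_ge0//.
by rewrite sqrtr_sqr.
Qed.

Let normr0_eq0 (x : E) : euclidean_norm x = 0 -> x = 0.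
Proof.
move=> /eqP; rewrite sqrtr_eq0 => h; apply: inner_eq0.
by apply/eqP; rewrite eq_le h inner_ge0.
Qed.

HB.instance Definition _ :=
  Lmodule_isNormed.Build R E ler_normD normrZ normr0_eq0.

Let coord_le_norm (x : E) i : `|x ord0 i| <= `|x|.
Proof.
rewrite [leRHS]/Num.norm/= /euclidean_norm -sqrtr_sqr ler_wsqrtr//.
rewrite /euclidean_inner (bigD1 i)//= -expr2 lerDl.
by apply: sumr_ge0 => j _; rewrite -expr2 sqr_ge0.
Qed.

Let norm_lt (x : E) (e : R) : 0 < e ->
  (forall i, `|x ord0 i| < e / d.+1%:R) -> `|x| < e.
Proof.
move=> e0 h; rewrite -(ger0_norm (ltW e0)) -[ltRHS]sqrtr_sqr.
rewrite [ltLHS]/Num.norm/= /euclidean_norm ltr_sqrt ?exprn_gt0//.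
apply: (@le_lt_trans _ _ (\sum_(i < d) (e / d.+1%:R) ^+ 2)).
  apply: ler_sum => i _; rewrite -expr2 -real_normK ?num_real//.
  by rewrite ler_sqr ?nnegrE ?divr_ge0// ?ltW.
rewrite sumr_const card_ord -[ltLHS]mulr_natr expr_div_n -mulrA.
rewrite gtr_pMr ?exprn_gt0// ltr_pdivrMl ?exprn_gt0// mulr1 -natrX ltr_nat.
by rewrite -mulnn (leq_trans (ltnSn _))// leq_pmulr.
Qed.

Let complete (F : set_system E) : ProperFilter F -> cauchy F -> cvg F.
Proof.
move=> FF /cauchyP Fc.
have ci (i : 'I_d) : cvg ((fun x : E => x ord0 i) @ F).
  apply/cauchy_cvgP/cauchyP => e e0; have [x Fx] := Fc _ e0.
  exists (x ord0 i).
  suff xe : ball x e `<=` (fun y : E => y ord0 i) @^-1` ball (x ord0 i) e.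
    exact: filterS xe Fx.
  move=> y; rewrite -!ball_normE /=; apply: le_lt_trans.
  by have := coord_le_norm (x - y) i; rewrite !mxE.
apply/cvg_ex.
exists (\row_i lim ((fun x : E => x ord0 i) @ F) : E).
apply/cvgrPdist_lt => e e0.
have h : F [set x : E | forall i : 'I_d,
    `|lim ((fun y : E => y ord0 i) @ F) - x ord0 i| < e / d.+1%:R].
  apply: filter_forall => i; move/cvgrPdist_lt : (ci i); apply.
  by rewrite divr_gt0.
apply: filterS h => x h; apply: norm_lt => // i.
by rewrite !mxE; exact: h.
Qed.

HB.instance Definition _ := Uniform_isComplete.Build E complete.

Let inner_bilinear : bilinear_for
  (GRing.Scale.Law.clone R R ( *%R ) _)
  (GRing.Scale.Law.clone R R (idfun \; *%R ) _) euclidean_inner.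
Proof.
split=> u a x y /=; first by rewrite innerD innerZ.
by rewrite innerC innerD innerZ ![euclidean_inner _ u]innerC.
Qed.

HB.instance Definition _ :=
  bilinear_isBilinear.Build R E E R _ _ euclidean_inner inner_bilinear.

Let inner_hermitian x y :
  euclidean_inner x y = (-1) ^+ false * idfun (euclidean_inner y x).
Proof. by rewrite expr0 mul1r innerC. Qed.

HB.instance Definition _ :=
  isHermitianSesquilinear.Build R E false idfun euclidean_inner inner_hermitian.

Let inner_gt0 x : x != 0 -> 0 < euclidean_inner x x.
Proof.
move=> x0; rewrite lt_neqAle inner_ge0 andbT eq_sym.
by apply: contra_neq x0; exact: inner_eq0.
Qed.

HB.instance Definition _ := isDotProduct.Build R E euclidean_inner inner_gt0.

Let euclidean_sqr_normE (x : E) :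
  `|x| ^+ 2 = (euclidean_inner : {dot E for (@idfun R)}) x x.
Proof. by rewrite sqr_sqrtr. Qed.

HB.instance Definition _ :=
  CompleteNormedModule_isHilbert.Build R E euclidean_sqr_normE.

Lemma separable_euclidean : separable E.
Proof.
exists (range (fun q : 'rV[rat]_d => map_mx ratr q : E)).
  exact: (card_le_trans (card_image_le _ _) (countableP _)).
move=> O [x Ox] oO.
have /nbhs_ballP[e /= e0 xeO] : nbhs x O by exact: open_nbhs_nbhs.
have ed : 0 < e / d.+1%:R by rewrite divr_gt0.
have h (i : 'I_d) : exists q : rat, `|x ord0 i - ratr q| < e / d.+1%:R.
  have b0 : ball (x ord0 i) (e / d.+1%:R) !=set0.
    by exists (x ord0 i); exact: ballxx.
  have [z [xz [q _ qz]]] := dense_rat b0 (ball_open _ _).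
  by exists q; move: xz; rewrite -ball_normE /= qz.
have [q qx] := choice h.
exists (map_mx ratr (\row_i q i)); split; last by exists (\row_i q i).
apply: xeO; rewrite -ball_normE /=; apply: norm_lt => // i.
by rewrite !mxE; exact: qx.
Qed.

End euclidean.

Definition borel (E : topologicalType) := g_sigma_algebraType (@open E).

HB.instance Definition _ (E : ptopologicalType) := Measurable.on (borel E).

Section random_elements.
Context {d : measure_display} {T : measurableType d} {R : realType}.
Variable P : probability T R.

(* X and Y are not bundled as measurable maps. For random variables,
   P (X @^-1` A) is distribution P X A. Only measurable A matter: outside the
   sigma-algebra, the values of a measure are unconstrained. *)
Definition eq_in_law d' (U : measurableType d') (X Y : T -> U) : Prop :=
  forall A, measurable A -> P (X @^-1` A) = P (Y @^-1` A).

Definition sigma_of d' (U : measurableType d') (X : T -> U) : set_system T :=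
  preimage_set_system setT X measurable.

(* Independence of a family of systems of events; it is applied to the
   sigma-algebras generated by random elements, whose codomains may differ. *)
Definition mutually_independent (I : finType) (F : I -> set_system T) : Prop :=
  forall (J : {set I}) (A : I -> set T), (forall i, i \in J -> F i (A i)) ->
    P (\bigcap_(i in [set` J]) A i) = (\prod_(i in J) P (A i))%E.

Definition fair_01 (X : T -> R) : Prop :=
  P (X @^-1` [set 0]) = (2^-1)%:E /\ P (X @^-1` [set 1]) = (2^-1)%:E.

End random_elements.

(* Main.v *)
(* Write K_s(x, y) = exp (- s |x - y|^2). As the distances are nonnegative, the
   symmetry of S says that the law of |X - Y| is the average of the laws of
   |X - X'| and |Y - Y'|; hence 2 E K_s(X, Y) = E K_s(X, X') + E K_s(Y, Y') for
   all s > 0. The kernel K_s is positive definite: the powers of the inner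
   product are so by Schur's product theorem, and K_s is a series in them up to
   a factor f(x) f(y). So the quadratic form of K_s on signed measures is
   nonnegative, and it vanishes at law(X) - law(Y); perturbing this measure by
   t times the Dirac mass at u gives E K_s(X, u) = E K_s(Y, u) for all u.
   Finally, products of Gaussians are multiples of Gaussians, so the Gaussians
   span an algebra whose bounded pointwise limits contain the indicators of all
   Borel sets, and the two laws coincide. *)
Require Import Defs.
From HB Require Import structures.
From mathcomp Require Import all_boot all_order all_algebra.
From mathcomp Require Import all_classical all_reals all_analysis.
From mathcomp Require Import measurable_realfun.
From mathcomp Require Import lra ring.

Set Implicit Arguments.
Unset Strict Implicit.
Unset Printing Implicit Defensive.

Import Order.TTheory GRing.Theory Num.Theory.
Import numFieldNormedType.Exports.

Local Open Scope classical_set_scope.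
Local Open Scope ring_scope.

(** * Positive semidefinite matrices, Schur products and the Gaussian kernel *)

Section positive_definite_kernels.
Context {R : realType} {E : hilbertType R}.
Implicit Types (x y z u v w : E) (a s t : R).

Lemma innerC x y : inner x y = inner y x.
Proof. by rewrite hermC expr0 mul1r. Qed.

Lemma innerDr x y z : inner x (y + z) = inner x y + inner x z.
Proof. by rewrite linearDr. Qed.

Lemma sqr_normD x y : `|x + y| ^+ 2 = `|x| ^+ 2 + `|y| ^+ 2 + 2 * inner x y.
Proof.
by rewrite !sqr_normE linearDl !linearDr/= (innerC y x); ring.
Qed.

Lemma sqr_normZ a x : `|a *: x| ^+ 2 = a ^+ 2 * `|x| ^+ 2.
Proof. by rewrite normrZ exprMn real_normK ?num_real. Qed.

Lemma innerZr a x y : inner x (a *: y) = a * inner x y.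
Proof. by rewrite linearZr. Qed.

Lemma innerZl a x y : inner (a *: x) y = a * inner x y.
Proof. by rewrite innerC innerZr innerC. Qed.

Lemma sqr_normB x y : `|x - y| ^+ 2 = `|x| ^+ 2 + `|y| ^+ 2 - 2 * inner x y.
Proof. by rewrite sqr_normD normrN -scaleN1r innerZr; ring. Qed.

Lemma sqr_norm_sum n (x : nat -> E) (c : nat -> R) :
  `|\sum_(i < n) c i *: x i| ^+ 2 =
  \sum_(i < n) \sum_(j < n) c i * c j * inner (x i) (x j).
Proof.
rewrite sqr_normE linear_sumlz; apply: eq_bigr => i _.
rewrite linear_sumr; apply: eq_bigr => j _ /=.
by rewrite innerZl innerZr; ring.
Qed.

(** Entries are indexed by [nat], so that one [B] serves every size and an induction on [n] passes
    to the leading block without casts. *)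
Definition psd n (B : nat -> nat -> R) :=
  (forall i j, B i j = B j i) /\
  forall c : nat -> R, 0 <= \sum_(i < n) \sum_(j < n) c i * c j * B i j.

Lemma double_sum_recr n (F : nat -> nat -> R) : (forall i j, F i j = F j i) ->
  \sum_(i < n.+1) \sum_(j < n.+1) F i j =
  \sum_(i < n) \sum_(j < n) F i j + 2 * \sum_(i < n) F i n + F n n.
Proof.
move=> Fsym; rewrite big_ord_recr/=.
under eq_bigr do rewrite big_ord_recr/=.
rewrite big_split/= [in X in _ + X]big_ord_recr/=.
under [\sum_(i < n) F n i]eq_bigr do rewrite Fsym.
by ring.
Qed.

(** The form at the vector [c] extended by a last coordinate [t]. As a polynomial in [t] it controls
    the last row of [B]. *)
Lemma psd_quadratic n B (c : nat -> R) t : psd n.+1 B ->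
  0 <= \sum_(i < n) \sum_(j < n) c i * c j * B i j
       + 2 * t * \sum_(i < n) c i * B i n + t ^+ 2 * B n n.
Proof.
pose e i := if (i < n)%N then c i else t.
move=> [Bsym /(_ e)].
rewrite (double_sum_recr n (F := fun i j => e i * e j * B i j)); last first.
  by move=> i j; rewrite Bsym; ring.
rewrite /e.
rewrite ltnn -expr2.
under eq_bigr => i _ do under eq_bigr => j _ do rewrite !ltn_ord.
under [X in _ + 2 * X]eq_bigr => i _ do
  rewrite ltn_ord (mulrC _ t) -mulrA.
by rewrite -mulr_sumr mulrA.
Qed.

Lemma psd_diag_ge0 n B : psd n.+1 B -> 0 <= B n n.
Proof.
move=> /(psd_quadratic (fun=> 0) 1).
rewrite !big1 => [|i _|i _]; rewrite ?mul0r//.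
  by rewrite mulr0 !add0r expr1n mul1r.
by apply: big1 => j _; rewrite !mul0r.
Qed.

(** With a zero leading coefficient the polynomial is affine in [t], and an affine function that
    stays nonnegative has slope zero. *)
Lemma psd_last0 n B (c : nat -> R) :
  psd n.+1 B -> B n n = 0 -> \sum_(i < n) c i * B i n = 0.
Proof.
move=> Bpsd b0; apply/eqP; set m := (X in X == 0); apply/negP => /negP m0.
(* This [t] brings the affine expression down to -1. *)
have := psd_quadratic c
  (- (\sum_(i < n) \sum_(j < n) c i * c j * B i j + 1) / (2 * m)) Bpsd.
rewrite b0 mulr0 addr0 -/m; set q := \sum_(i < n) _.
have -> : 2 * (- (q + 1) / (2 * m)) * m = - (q + 1) by field.
by lra.
Qed.

(* For [B n n = 0] the quotient is [0] and the last row of [B] vanishes. *)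
Lemma psd_schur_complement n B : psd n.+1 B ->
  psd n (fun i j => B i j - B i n * B j n / B n n).
Proof.
move=> Bpsd; have [Bsym _] := Bpsd; split=> [i j|c].
  by rewrite Bsym; ring.
set m := \sum_(i < n) c i * B i n.
have -> : \sum_(i < n) \sum_(j < n) c i * c j *
    (B i j - B i n * B j n / B n n) =
    \sum_(i < n) \sum_(j < n) c i * c j * B i j - m ^+ 2 / B n n.
  rewrite expr2 {1}/m mulr_suml mulr_suml -sumrB; apply: eq_bigr => i _.
  rewrite /m mulr_sumr mulr_suml -sumrB.
  by apply: eq_bigr => j _; ring.
have [b0|b0] := eqVneq (B n n) 0.
  have := psd_quadratic c 0 Bpsd.
  by rewrite b0 invr0 !mulr0 subr0 mul0r !addr0.
(* This [t] minimizes the quadratic; the minimum is the form of the Schur complement at [c]. *)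
have := psd_quadratic c (- m / B n n) Bpsd; rewrite -/m.
set q := \sum_(i < n) _.
suff -> : q + 2 * (- m / B n n) * m + (- m / B n n) ^+ 2 * B n n =
  q - m ^+ 2 / B n n by [].
by field.
Qed.

(** Schur's product theorem, by elimination of the last index. [B] is its Schur complement plus the
    rank-one matrix [B i n * B j n / B n n]; induction handles the first, and the second contributes
    the squared norm of [\sum_i B i n *: x i] divided by [B n n]. *)
Lemma schur_product_sum_ge0 n B (x : nat -> E) : psd n B ->
  0 <= \sum_(i < n) \sum_(j < n) inner (x i) (x j) * B i j.
Proof.
elim: n B => [|n ih] B Bpsd; first by rewrite big_ord0.
have [Bsym _] := Bpsd.
rewrite (double_sum_recr n (F := fun i j => inner (x i) (x j) * B i j));
  last by move=> i j; rewrite innerC Bsym.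
have := ih _ (psd_schur_complement Bpsd).
have [b0|b0] := eqVneq (B n n) 0.
  have Bn (i : 'I_n) : B i n = 0.
    have := psd_last0 (fun k => (k == i)%:R) Bpsd b0.
    rewrite (bigD1 i)//= eqxx mul1r big1 ?addr0// => j ji.
    by rewrite (negbTE ji : (j == i :> nat) = false) mul0r.
  under eq_bigr => i _ do under eq_bigr => j _ do rewrite Bn !mul0r subr0.
  under [\sum_(i < n) (_ * B i n)]eq_bigr => i _ do rewrite Bn mulr0.
  by rewrite b0 big1_eq !mulr0 !addr0.
move=> h.
set q := \sum_(i < n) \sum_(j < n) inner (x i) (x j) * B i j.
have := sqr_norm_sum n.+1 x (fun i => B i n).
rewrite (double_sum_recr n
  (F := fun i j => B i n * B j n * inner (x i) (x j)));
  last by move=> i j; rewrite innerC; ring.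
set q' := \sum_(i < n) \sum_(j < n) B i n * _ * _ => sq.
have hE : 0 <= q - q' / B n n.
  move: h; congr (_ <= _).
  rewrite mulr_suml -sumrB; apply: eq_bigr => i _.
  by rewrite mulr_suml -sumrB; apply: eq_bigr => j _; ring.
have -> : q + 2 * \sum_(i < n) inner (x i) (x n) * B i n
    + inner (x n) (x n) * B n n =
  (q - q' / B n n) + `|\sum_(i < n.+1) B i n *: x i| ^+ 2 / B n n.
  rewrite sq.
  have -> : \sum_(i < n) B i n * B n n * inner (x i) (x n) =
      B n n * \sum_(i < n) inner (x i) (x n) * B i n.
    by rewrite mulr_sumr; apply: eq_bigr => i _; ring.
  by field.
by rewrite addr_ge0// divr_ge0// ?sqr_ge0// (psd_diag_ge0 Bpsd).
Qed.

(** Each further factor is one Schur product, with the weights [c i * c j] absorbed into the matrix;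
    for [k = 0] the form is the square of the sum of the weights. *)
Lemma psd_expn_inner n (x : nat -> E) k :
  psd n (fun i j => inner (x i) (x j) ^+ k).
Proof.
elim: k => [|k [ihC ih]]; split.
- by move=> i j; rewrite innerC.
- move=> c; suff -> : \sum_(i < n) \sum_(j < n)
    c i * c j * inner (x i) (x j) ^+ 0 = (\sum_(i < n) c i) ^+ 2.
    exact: sqr_ge0.
  rewrite expr2 mulr_suml; apply: eq_bigr => i _; rewrite mulr_sumr.
  by apply: eq_bigr => j _; rewrite expr0 mulr1.
- by move=> i j; rewrite innerC.
- move=> c.
  have Bpsd : psd n (fun i j => c i * c j * inner (x i) (x j) ^+ k).
    split=> [i j|c']; first by rewrite innerC; ring.
    have := ih (fun i => c' i * c i); congr (_ <= _).
    by apply: eq_bigr => i _; apply: eq_bigr => j _; ring.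
  have := schur_product_sum_ge0 x Bpsd; congr (_ <= _).
  by apply: eq_bigr => i _; apply: eq_bigr => j _; rewrite exprS; ring.
Qed.

Definition gauss s u x : R := expR (- (s * `|x - u| ^+ 2)).

Lemma gaussC s x y : gauss s x y = gauss s y x.
Proof. by rewrite /gauss distrC. Qed.

Lemma gaussxx s u : gauss s u u = 1.
Proof. by rewrite /gauss subrr normr0 expr0n/= mulr0 oppr0 expR0. Qed.

Lemma gauss_ge0 s u x : 0 <= gauss s u x.
Proof. exact: expR_ge0. Qed.

Lemma gauss_le1 s u x : 0 <= s -> gauss s u x <= 1.
Proof.
by move=> s0; rewrite -expR0 ler_expR oppr_le0 mulr_ge0// sqr_ge0.
Qed.

(** Completing the square: the new centre is the barycentre of [u] and [v] with weights [s] and [t],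
    and the remaining factor does not depend on [x]. *)
Lemma gaussM s t u v x : 0 < s -> 0 < t ->
  gauss s u x * gauss t v x =
  expR (- (s * t / (s + t) * `|u - v| ^+ 2)) *
  gauss (s + t) ((s + t)^-1 *: (s *: u + t *: v)) x.
Proof.
move=> s0 t0; have st : s + t != 0 by rewrite gt_eqF ?addr_gt0.
rewrite /gauss -!expRD; congr expR.
rewrite !(sqr_normB, sqr_normZ, sqr_normD, innerZr, innerZl, innerDr).
by field.
Qed.

(** The squared norms in the expanded exponent go into the weights [c']. What is left is the
    exponential of [2 * s * inner (x i) (x j)], a limit of partial sums whose coefficients are
    nonnegative because [0 <= s]. *)
Lemma gauss_psd n s (x : nat -> E) : 0 <= s ->
  psd n (fun i j => gauss s (x i) (x j)).
Proof.
move=> s0; split=> [i j|c]; first exact: gaussC.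
pose c' i := c i * expR (- (s * `|x i| ^+ 2)).
pose S N := \sum_(i < n) \sum_(j < n) c' i * c' j *
  series (exp_coeff (2 * s * inner (x i) (x j))) N.
have -> : \sum_(i < n) \sum_(j < n) c i * c j * gauss s (x i) (x j) =
  \sum_(i < n) \sum_(j < n) c' i * c' j * expR (2 * s * inner (x i) (x j)).
  apply: eq_bigr => i _; apply: eq_bigr => j _.
  rewrite /c' /gauss.
  have -> : - (s * `|x j - x i| ^+ 2) =
      - (s * `|x i| ^+ 2) + - (s * `|x j| ^+ 2) + 2 * s * inner (x i) (x j).
    by rewrite sqr_normB (innerC (x j)); ring.
  by rewrite !expRD; ring.
have Scvg : S @ \oo --> \sum_(i < n) \sum_(j < n)
    c' i * c' j * expR (2 * s * inner (x i) (x j)).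
  apply: cvg_big => [|i _]; first exact: add_continuous.
  apply: cvg_big => [|j _]; first exact: add_continuous.
  by apply: cvgMl_tmp; exact: is_cvg_series_exp_coeff.
apply: (cvgr_to_ge Scvg); apply: nearW => N; rewrite /S.
under eq_bigr => i _ do under eq_bigr => j _ do rewrite /series/= mulr_sumr.
under eq_bigr => i _ do rewrite exchange_big/=.
rewrite exchange_big/=; apply: sumr_ge0 => k _.
have := (psd_expn_inner n x k).2 c'.
have k0 : 0 <= (2 * s) ^+ k / k`!%:R :> R.
  by rewrite divr_ge0// exprn_ge0// mulr_ge0.
move=> /(mulr_ge0 k0); congr (_ <= _).
rewrite mulr_sumr; apply: eq_bigr => i _; rewrite mulr_sumr.
by apply: eq_bigr => j _; rewrite /exp_coeff/= (exprMn k (2 * s)); ring.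
Qed.

End positive_definite_kernels.

(** * Polynomials converging to the indicator of [y < 1/2] *)

Section threshold.
Context {R : realType}.
Implicit Types (y q r : R) (n m : nat).

(** Bernoulli's inequality; [y <= 1] keeps the factor [1 - y] of the induction step nonnegative. *)
Lemma expr_onem_ge y m : 0 <= y <= 1 -> 1 - m%:R * y <= (1 - y) ^+ m.
Proof.
move=> /andP[y0 y1]; elim: m => [|m ih]; first by rewrite mul0r subr0 expr0.
rewrite exprS; have := ler_wpM2l (_ : 0 <= 1 - y) ih; rewrite subr_ge0.
move=> /(_ y1); apply: le_trans; rewrite -natr1.
have : 0 <= m%:R * y ^+ 2 by rewrite mulr_ge0// sqr_ge0.
by move=> h; nra.
Qed.

(** Multiplying [1 + r + ... + r ^+ (n - 1)] by [1 - r] gives [1 - r ^+ n], and each of the [n]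
    summands is at least [r ^+ n]. *)
Lemma natr_mul_expr_le r n : 0 <= r <= 1 ->
  n%:R * (1 - r) * r ^+ n <= 1 - r ^+ n.
Proof.
move=> /andP[r0 r1]; elim: n => [|n ih]; first by rewrite !mul0r expr0 subrr.
have rn1 : r ^+ n <= 1 by rewrite exprn_ile1.
have rn0 : 0 <= r ^+ n by rewrite exprn_ge0.
have := ler_wpM2l r0 ih.
rewrite exprS -natr1; set u := r ^+ n in rn0 rn1 *.
move=> h; have : 0 <= (1 - r) * (1 - r * u).
  by rewrite mulr_ge0 ?subr_ge0// mulr_ile1.
by nra.
Qed.

(** With [r] the square root of [q], the term is [n%:R * r ^+ n] times [r ^+ n]; the first factor is
    bounded by [(1 - r)^-1], the second tends to 0. *)
Lemma cvg_natr_mul_expr q : 0 <= q < 1 ->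
  n%:R * q ^+ n @[n --> \oo] --> (0 : R).
Proof.
move=> /andP[q0 q1]; pose r := Num.sqrt q.
have r0 : 0 <= r by rewrite sqrtr_ge0.
have r1 : r < 1 by rewrite -sqrtr1 ltr_sqrt.
have rc : (1 - r)^-1 * r ^+ n @[n --> \oo] --> (0 : R).
  rewrite -[X in _ --> X](mulr0 (1 - r)^-1).
  by apply: cvgMl_tmp; apply: cvg_expr; rewrite ger0_norm.
apply: (squeeze_cvgr _ (cvg_cst 0) rc); apply: nearW => n.
rewrite mulr_ge0 ?exprn_ge0//=.
have -> : q = r ^+ 2 by rewrite sqr_sqrtr.
rewrite exprAC expr2 mulrA ler_wpM2r ?exprn_ge0//.
rewrite -(@ler_pM2l _ (1 - r)) ?subr_gt0// divff; last first.
  by rewrite subr_eq0 eq_sym lt_eqF.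
have := @natr_mul_expr_le r n; rewrite r0 ltW// => /(_ isT).
have : 0 <= r ^+ n by rewrite exprn_ge0.
by move: (r ^+ n) => u u0 h; nra.
Qed.

(* The factor [n] in the exponent makes the limit vanish also at [y = 1/2]. *)
Lemma cvg_threshold y : 0 <= y <= 1 ->
  (1 - y ^+ n) ^+ (n * 2 ^ n) @[n --> \oo] --> ((2 * y < 1)%R%:R : R).
Proof.
move=> /andP[y0 y1].
have yn n : 0 <= y ^+ n <= 1 by rewrite exprn_ge0//= exprn_ile1.
have E n : (n * 2 ^ n)%:R * y ^+ n = n%:R * (2 * y) ^+ n.
  by rewrite natrM natrX exprMn mulrA.
(* Below 1/2, Bernoulli's inequality gives the lower bound [1 - n%:R * (2 * y) ^+ n]; from 1/2 on,
   [1 - a <= expR (- a)] gives the upper bound [expR (- 1) ^+ n]. *)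
have [y2|y2] := ltP (2 * y) 1; rewrite /= ?mulr1n ?mulr0n.
- have hc : 1 - n%:R * (2 * y) ^+ n @[n --> \oo] --> (1 : R).
    rewrite -[X in _ --> X]subr0; apply: cvgB; first exact: cvg_cst.
    by apply: cvg_natr_mul_expr; rewrite y2 mulr_ge0.
  have := @squeeze_cvgr _ _ _ R _ (fun=> 1) _ _ 1 hc (cvg_cst _).
  apply; apply: nearW => n /=.
  rewrite -E expr_onem_ge//= exprn_ile1//.
    by rewrite subr_ge0; case/andP: (yn n).
  by rewrite gerBl exprn_ge0.
- have hc : expR (- 1) ^+ n @[n --> \oo] --> (0 : R).
    apply: cvg_expr; rewrite ger0_norm ?expR_ge0// expR_lt1 ltrN10.
  apply: (squeeze_cvgr _ (cvg_cst 0) hc); apply: nearW => n /=.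
  have u0 : 0 <= 1 - y ^+ n by rewrite subr_ge0; case/andP: (yn n).
  rewrite exprn_ge0//=.
  apply: (@le_trans _ _ (expR (- y ^+ n) ^+ (n * 2 ^ n))).
    by rewrite lerXn2r ?nnegrE ?expR_ge0// expR_ge1Dx.
  rewrite -!expRM_natl ler_expR mulrN E mulrN1 lerN2.
  by rewrite ler_peMr// exprn_ege1.
Qed.

End threshold.

(** * Integrals of bounded measurable functions *)

Section bounded_measurable.
Context d (T : measurableType d) (R : realType).
Implicit Types (f g : T -> R) (P : probability T R).

(** Gives integrability under every probability measure at once, as needed when two measures are
    compared on the same functions. *)
Definition bounded_measurable f :=
  measurable_fun setT f /\ exists M, forall x, `|f x| <= M.

Lemma bounded_measurable_cst a : bounded_measurable (fun=> a).
Proof. by split; [exact: measurable_cst|exists `|a|]. Qed.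

Lemma bounded_measurable_lin a f g : bounded_measurable f ->
  bounded_measurable g -> bounded_measurable (fun x => a * f x + g x).
Proof.
move=> [mf [M fM]] [mg [N gN]]; split.
  by apply: measurable_funD => //; apply: measurable_funM.
exists (`|a| * M + N) => x; rewrite (le_trans (ler_normD _ _))// lerD//.
by rewrite normrM ler_wpM2l.
Qed.

Lemma bounded_measurableM f g : bounded_measurable f ->
  bounded_measurable g -> bounded_measurable (fun x => f x * g x).
Proof.
move=> [mf [M fM]] [mg [N gN]]; split; first exact: measurable_funM.
by exists (M * N) => x; rewrite normrM ler_pM.
Qed.

Lemma bounded_measurable_indic A : measurable A ->
  bounded_measurable (\1_A : T -> R).
Proof.
move=> mA; split; first exact: measurable_indic.
by exists 1 => x; rewrite indicE; case: (x \in A); rewrite ?normr1 ?normr0.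
Qed.

Lemma bounded_measurable_cvg (f_ : nat -> T -> R) f M :
  (forall n, measurable_fun setT (f_ n)) -> (forall n x, `|f_ n x| <= M) ->
  (forall x, f_ ^~ x @ \oo --> f x) -> bounded_measurable f.
Proof.
move=> mf fM ff; split.
  by apply: (measurable_realfun.measurable_fun_cvg mf) => x _; exact: ff.
exists M => x; apply: (cvgr_to_le (cvg_norm (ff x))).
by apply: nearW => n.
Qed.

Lemma bounded_measurable_integrable P f : bounded_measurable f ->
  P.-integrable setT (EFin \o f).
Proof.
move=> [mf [M fM]]; apply: measurable_bounded_integrable => //.
  by rewrite (le_lt_trans (probability_le1 _ _))// ltry.
exists M; split; first exact: num_real.
by move=> N MN x _; exact: le_trans (fM x) (ltW MN).
Qed.

Lemma Rintegral_lin P a f g : bounded_measurable f -> bounded_measurable g ->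
  \int[P]_x (a * f x + g x) = a * \int[P]_x f x + \int[P]_x g x.
Proof.
move=> bf bg; rewrite -RintegralZl//; last exact: bounded_measurable_integrable.
rewrite RintegralD//; last exact: bounded_measurable_integrable.
apply: bounded_measurable_integrable; have := bounded_measurable_cst 0.
move=> /(bounded_measurable_lin a bf); congr bounded_measurable.
by apply/funext => x; rewrite addr0.
Qed.

(** Dominated convergence with the constant [M] as dominating function, integrable because [P] is
    finite. *)
Lemma Rintegral_bounded_cvg P (f_ : nat -> T -> R) f M :
  (forall n, measurable_fun setT (f_ n)) -> (forall n x, `|f_ n x| <= M) ->
  (forall x, f_ ^~ x @ \oo --> f x) ->
  \int[P]_x f_ n x @[n --> \oo] --> \int[P]_x f x.
Proof.
move=> mf fM ff; have bf := bounded_measurable_cvg mf fM ff.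
have [||||| _ _ h] := @dominated_convergence _ _ _ P setT measurableT
  (fun n => EFin \o f_ n) (EFin \o f) (EFin \o fun=> M).
- by move=> n; exact/measurable_EFinP.
- by apply/measurable_EFinP; exact: bf.1.
- by apply: aeW => x _; apply: cvg_EFin; [exact: nearW|exact: ff].
- by apply: bounded_measurable_integrable; exact: bounded_measurable_cst.
- by apply: aeW => x n _; rewrite /= lee_fin.
apply: fine_cvg; rewrite fineK; first exact: h.
by apply: integrable_fin_num => //; exact: bounded_measurable_integrable.
Qed.

Lemma Rintegral_indic P A : measurable A -> \int[P]_x (\1_A x) = fine (P A).
Proof. by move=> mA; rewrite /Rintegral integral_indic// setIT. Qed.

End bounded_measurable.

(** * Dense sequences and Borel measurability *)

Lemma separable_seq (E : ptopologicalType) : separable E ->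
  exists q : nat -> E, forall O, O !=set0 -> open O -> exists n, O (q n).
Proof.
(* A countable set is empty or the image of a sequence, and a dense set in a pointed space is not
   empty. *)
move=> [D /pfcard_geP[->|[q]] dD]; first by have := dense0 dD.
exists q => O O0 oO; have [x [Ox Dx]] := dD O O0 oO.
have [n _ qn] : (q @` setT) x by exact: surj.
by exists n; rewrite qn.
Qed.

Lemma open_borel_measurable (E : ptopologicalType) (O : set E) :
  open O -> measurable (O : set (borel E)).
Proof. by move=> oO; exact: sub_sigma_algebra. Qed.

Lemma continuous_borel_measurable (E : ptopologicalType) (R : realType)
    (f : E -> R) :
  continuous f -> measurable_fun setT (f : borel E -> R).
Proof.
move=> cf.
apply: (measurability _ (RGenOInfty.measurableE R)) => _ [_ [x ->] <-].
rewrite setTI; apply: open_borel_measurable.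
by apply: open_comp => [y _|]; [exact: cf|exact: itv_open_ends_open].
Qed.

(** * Gaussian integrals determine a Borel probability measure *)

Section gauss_determining.
Context {R : realType} {E : hilbertType R}.
Implicit Types (x u : E) (s a : R).

Lemma continuous_gauss s u : continuous (gauss s u).
Proof.
move=> x; apply: continuous_comp; last exact: continuous_expR.
apply: cvgN; apply: cvgMl_tmp.
apply: (@cvg_comp _ _ _ (fun y => `|y - u|) (fun a => a ^+ 2)).
  by apply: cvg_norm; apply: cvgB; [exact: cvg_id|exact: cvg_cst].
exact: exprn_continuous.
Qed.

Lemma bounded_measurable_gauss s u : 0 < s ->
  bounded_measurable (gauss s u : borel E -> R).
Proof.
move=> s0; split.
  exact: continuous_borel_measurable (@continuous_gauss s u).
by exists 1 => x; rewrite ger0_norm ?gauss_ge0// gauss_le1// ltW.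
Qed.

Lemma gauss_lt_half s u x : (2 * gauss s u x < 1) = (ln 2 < s * `|x - u| ^+ 2).
Proof.
rewrite -(ltr_pM2l (_ : 0 < 2^-1)) ?invr_gt0// mulKf// mulr1.
by rewrite -[X in _ < X](@lnK R) ?posrE ?invr_gt0// ltr_expR lnV ?posrE// ltrN2.
Qed.

Variables mu nu : probability (borel E) R.
Hypothesis eq_gauss : forall s u, 0 < s ->
  \int[mu]_x gauss s u x = \int[nu]_x gauss s u x.

(** Testing [f] against every Gaussian, rather than only integrating it, is what makes the class
    stable under multiplication by Gaussians. *)
Let undistinguished (f : borel E -> R) := bounded_measurable f /\
  forall s u, 0 < s ->
    \int[mu]_x (f x * gauss s u x) = \int[nu]_x (f x * gauss s u x).

(* The multipliers of [undistinguished] form an algebra that is closed under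
   bounded pointwise limits and, products of Gaussians being multiples of
   Gaussians, contains the Gaussians. *)
Let multiplier (f : borel E -> R) :=
  forall h, undistinguished h -> undistinguished (fun x => f x * h x).

Let undistinguished_lin a f g : undistinguished f -> undistinguished g ->
  undistinguished (fun x => a * f x + g x).
Proof.
move=> [bf ef] [bg eg]; split; first exact: bounded_measurable_lin.
move=> s u s0; have bu := bounded_measurable_gauss u s0.
under eq_Rintegral do rewrite mulrDl -mulrA.
under [RHS]eq_Rintegral do rewrite mulrDl -mulrA.
have bfu := bounded_measurableM bf bu; have bgu := bounded_measurableM bg bu.
by rewrite (Rintegral_lin mu _ bfu bgu) (Rintegral_lin nu _ bfu bgu) ef// eg.
Qed.

Let undistinguished_cvg (f_ : nat -> borel E -> R) (f : borel E -> R) (M : R) :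
  (forall n, undistinguished (f_ n)) ->
  (forall n x, `|f_ n x| <= M) -> (forall x, f_ ^~ x @ \oo --> f x) ->
  undistinguished f.
Proof.
move=> Hf fM ff; have mf n : measurable_fun setT (f_ n) by case: (Hf n) => -[].
split; first exact: (@bounded_measurable_cvg _ (borel E) R f_ f M).
move=> s u s0; have [mu_ _] := bounded_measurable_gauss u s0.
have mfu n : measurable_fun setT (fun x : borel E => f_ n x * gauss s u x).
  exact: measurable_funM.
have fuM n x : `|f_ n x * gauss s u x| <= M.
  rewrite normrM -[leRHS]mulr1 ler_pM// ger0_norm ?gauss_ge0//.
  by rewrite gauss_le1// ltW.
have ffu x : f_ n x * gauss s u x @[n --> \oo] --> f x * gauss s u x.
  by apply: cvgMr_tmp; exact: ff.
have h1 := Rintegral_bounded_cvg (P := mu) mfu fuM ffu.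
have h2 := Rintegral_bounded_cvg (P := nu) mfu fuM ffu.
have e : (fun n => \int[mu]_x (f_ n x * gauss s u x)) =
    (fun n => \int[nu]_x (f_ n x * gauss s u x)).
  by apply/funext => n; have [_ ->] := Hf n.
by rewrite e in h1; exact: cvg_unique h1 h2.
Qed.

(** The hypothesis [eq_gauss] enters here; indicators are then reached from the constant 1 by
    multipliers. *)
Let undistinguished1 : undistinguished (fun=> 1).
Proof.
split; first exact: bounded_measurable_cst.
move=> s u s0; under eq_Rintegral do rewrite mul1r.
by under [RHS]eq_Rintegral do rewrite mul1r; exact: eq_gauss.
Qed.

Let multiplier_undistinguished f : multiplier f -> undistinguished f.
Proof.
move=> /(_ _ undistinguished1); congr undistinguished.
by apply/funext => x; rewrite mulr1.
Qed.

Let multiplier_lin a f g : multiplier f -> multiplier g ->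
  multiplier (fun x => a * f x + g x).
Proof.
move=> mf mg h Hh; have := undistinguished_lin a (mf _ Hh) (mg _ Hh).
by congr undistinguished; apply/funext => x; ring.
Qed.

Let multiplierM f g : multiplier f -> multiplier g ->
  multiplier (fun x => f x * g x).
Proof.
move=> mf mg h Hh; have := mf _ (mg _ Hh).
by congr undistinguished; apply/funext => x; ring.
Qed.

Let multiplier1 : multiplier (fun=> 1).
Proof.
by move=> h; congr undistinguished; apply/funext => x; rewrite mul1r.
Qed.

Let multiplier0 : multiplier (fun=> 0).
Proof.
have := multiplier_lin (-1) multiplier1 multiplier1.
by congr multiplier; apply/funext => x; ring.
Qed.

Let multiplier_onem f : multiplier f -> multiplier (fun x => 1 - f x).
Proof.
move=> mf; have := multiplier_lin (-1) mf multiplier1.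
by congr multiplier; apply/funext => x; ring.
Qed.

Let multiplierX f n : multiplier f -> multiplier (fun x => f x ^+ n).
Proof.
move=> mf; elim: n => [|n ih]; first exact: multiplier1.
have := multiplierM mf ih.
by congr multiplier; apply/funext => x; rewrite exprS.
Qed.

Let multiplier_cvg (f_ : nat -> borel E -> R) (f : borel E -> R) (M : R) :
  (forall n, multiplier (f_ n)) ->
  (forall n x, `|f_ n x| <= M) -> (forall x, f_ ^~ x @ \oo --> f x) ->
  multiplier f.
Proof.
move=> mf fM ff h Hh; have [[_ [N hN]] _] := Hh.
apply: (@undistinguished_cvg (fun n x => f_ n x * h x) _ (M * N)).
- by move=> n; exact: mf.
- by move=> n x; rewrite normrM ler_pM.
- by move=> x; apply: cvgMr_tmp; exact: ff.
Qed.

Let multiplier_gauss s u : 0 < s -> multiplier (gauss s u).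
Proof.
move=> s0 h Hh; have [bh eh] := Hh; split.
  by apply: bounded_measurableM => //; exact: bounded_measurable_gauss.
move=> t v t0; have st0 : 0 < s + t by rewrite addr_gt0.
set w : E := (s + t)^-1 *: (s *: u + t *: v).
set c : R := expR (- (s * t / (s + t) * `|u - v| ^+ 2)).
have e x : gauss s u x * h x * gauss t v x = c * (h x * gauss (s + t) w x).
  by rewrite mulrAC gaussM// -/w -/c; ring.
under eq_Rintegral do rewrite e.
under [RHS]eq_Rintegral do rewrite e.
have bhw := bounded_measurableM bh (bounded_measurable_gauss w st0).
by rewrite !RintegralZl ?eh//; exact: bounded_measurable_integrable.
Qed.

(** Complements come from [1 - f], finite unions from products of complements, and countable unions
    as bounded limits of finite ones, eventually constant at each point. *)
Let multiplier_sigma_algebra :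
  sigma_algebra setT [set A : set (borel E) | multiplier \1_A].
Proof.
have mC A : multiplier \1_A -> multiplier \1_(~` A).
  move=> /multiplier_onem; congr multiplier; apply/funext => x.
  by rewrite indicC indicE; case: (x \in A); rewrite /= ?subrr ?subr0.
have m0 : multiplier \1_(set0 : set (borel E)).
  by move: multiplier0; congr multiplier; apply/funext => x; rewrite indic0.
have mU A B : multiplier \1_A -> multiplier \1_B -> multiplier \1_(A `|` B).
  move=> mA mB; rewrite -[A `|` B]setCK setCU; apply/mC.
  by rewrite indicI; apply: multiplierM; exact: mC.
split=> [//|A mA|A mA] /=; first by rewrite setTD; exact: mC.
apply: (@multiplier_cvg (fun n => \1_(\big[setU/set0]_(k < n) A k)) _ 1).
- move=> n; elim: n => [|n ih]; first by rewrite big_ord0.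
  by rewrite big_ord_recr/=; apply: mU => //; exact: mA.
- by move=> n x; rewrite indicE; case: (_ \in _); rewrite ?normr1 ?normr0.
- move=> x; apply: cvg_near_cst; rewrite !indicE.
  have [xA|xA] := boolP (x \in \bigcup_k A k).
    move: xA; rewrite inE => -[k _ Akx]; near=> n.
    rewrite indicE mem_set// -bigcup_mkord; exists k => //=.
    by near: n; exact: nbhs_infty_gt.
  apply: nearW => n; rewrite indicE memNset// -bigcup_mkord => -[k _ Akx].
  by move/negP: xA; apply; rewrite inE; exists k.
Unshelve. all: by end_near. Qed.

(** For [0 < s], the closed ball around [u] of radius [Num.sqrt (ln 2 / s)], on which the Gaussian
    is at least 1/2. *)
Let sublevel s u : set (borel E) := [set x | s * `|(x : E) - u| ^+ 2 <= ln 2].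

(** On the complement the Gaussian is below 1/2; the indicator of that event is the limit of the
    threshold polynomials in the Gaussian, which are multipliers with values in [0, 1]. *)
Let multiplier_sublevel s u : 0 < s -> multiplier \1_(sublevel s u).
Proof.
move=> s0; suff : multiplier (fun x => (2 * gauss s u x < 1)%R%:R).
  move=> /multiplier_onem; congr multiplier; apply/funext => x.
  rewrite indicE gauss_lt_half ltNge.
  rewrite (_ : (x \in sublevel s u) = (s * `|(x : E) - u| ^+ 2 <= ln 2)).
    by case: (_ <= _); rewrite /= ?subrr ?subr0.
  by apply/idP/idP; rewrite inE.
have g01 x : 0 <= gauss s u x <= 1 by rewrite gauss_ge0 gauss_le1// ltW.
apply: (@multiplier_cvg (fun n x => (1 - gauss s u x ^+ n) ^+ (n * 2 ^ n)) _ 1).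
- by move=> n; apply/multiplierX/multiplier_onem/multiplierX/multiplier_gauss.
- move=> n x; have /andP[g0 g1] := g01 x.
  have h1 : 0 <= 1 - gauss s u x ^+ n by rewrite subr_ge0 exprn_ile1.
  by rewrite ger0_norm ?exprn_ge0// exprn_ile1// gerBl exprn_ge0.
- by move=> x; exact: cvg_threshold.
Qed.

Hypothesis sepE : separable E.

(** By separability an open set is the union of those balls [sublevel n.+1%:R (q k)] that it
    contains, so the sigma-algebra of multipliers contains all open sets. *)
Let multiplier_measurable (A : set (borel E)) :
  measurable A -> multiplier \1_A.
Proof.
apply: (smallest_sub multiplier_sigma_algebra) => O oO.
have [msa0 _ msaU] := multiplier_sigma_algebra.
have [q dq] := separable_seq sepE.
pose B n k := if `[< sublevel n.+1%:R (q k) `<=` O >]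
  then sublevel n.+1%:R (q k) else set0.
have -> : O = \bigcup_n \bigcup_k B n k.
  apply/seteqP; split=> [x Ox|x [n _ [k _]]]; last first.
    by rewrite /B; case: asboolP => // + Bx; apply.
  have /nbhs_ballP[e /= e0 xeO] : nbhs (x : E) O by exact: open_nbhs_nbhs.
  have l2 : 0 < ln 2 :> R by rewrite ln_gt0// ltr1n.
  (* So large an [n] makes the radius of the balls less than [e / 2]. *)
  have [n hn] : exists n, ln 2 / n.+1%:R < (e / 2) ^+ 2.
    exists (Num.truncn (ln 2 / (e / 2) ^+ 2)).
    rewrite ltr_pdivrMr// mulrC -ltr_pdivrMr ?exprn_gt0 ?divr_gt0//.
    by rewrite truncnS_gt.
  (* The first bound keeps the ball around [q k] inside the [e]-ball at [x]; the second puts [x]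
     into it. *)
  pose r := Num.min (e / 2) (Num.sqrt (ln 2 / n.+1%:R)).
  have r0 : 0 < r by rewrite lt_min divr_gt0//= sqrtr_gt0 divr_gt0.
  have [k xqk] : exists k, ball (x : E) r (q k).
    by apply: dq; [exists x; exact: ballxx|exact: ball_open].
  move: xqk; rewrite -ball_normE /= lt_min => /andP[xq1 xq2].
  exists n => //; exists k => //; rewrite /B asboolT.
    rewrite /sublevel/= mulrC -ler_pdivlMr//.
    have ln0 : 0 <= ln 2 / n.+1%:R :> R by rewrite divr_ge0// ltW.
    by rewrite -(sqr_sqrtr ln0) lerXn2r ?nnegrE ?sqrtr_ge0// ltW.
  move=> z; rewrite /sublevel/= mulrC -ler_pdivlMr// => /le_lt_trans /(_ hn).
  have e2 : 0 <= e / 2 by rewrite divr_ge0// ltW.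
  rewrite ltr_pXn2r ?nnegrE// => zq.
  apply: xeO; rewrite -ball_normE /= -(subrKA (q k)) (splitr e).
  by rewrite (le_lt_trans (ler_normD _ _))// ltrD// distrC.
apply: (msaU) => n; apply: (msaU) => k; rewrite /B.
by case: ifPn => _; [exact: multiplier_sublevel|exact: msa0].
Qed.

(** The indicator of [A] has equal integrals against all Gaussians; those centred at 0 with
    parameter [n.+1%:R^-1] widen to the constant 1, and bounded convergence removes them. *)
Lemma gauss_determining (A : set (borel E)) : measurable A -> mu A = nu A.
Proof.
move=> mA.
have [[m1 [M fM]] e1] := multiplier_undistinguished (multiplier_measurable mA).
have g n : 0 < n.+1%:R^-1 :> R by rewrite invr_gt0.
have gc (x : E) : gauss n.+1%:R^-1 0 x @[n --> \oo] --> (1 : R).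
  rewrite -[X in _ --> X]expR0; apply: continuous_cvg.
    exact: continuous_expR.
  rewrite -[X in _ --> X]oppr0 -[X in _ --> - X](mul0r (`|x - 0| ^+ 2)).
  by apply: cvgN; apply: cvgMr_tmp; exact: (@cvg_harmonic R).
have lim (m : probability (borel E) R) :
    \int[m]_x (\1_A x * gauss n.+1%:R^-1 0 x) @[n --> \oo] --> fine (m A).
  rewrite -Rintegral_indic//; apply: (@Rintegral_bounded_cvg _ _ _ _ _ _ 1).
  - move=> n; apply: measurable_funM => //.
    exact: (bounded_measurable_gauss 0 (g n)).1.
  - move=> n x; rewrite normrM mulr_ile1//.
      by rewrite indicE; case: (_ \in _); rewrite ?normr1 ?normr0.
    by rewrite ger0_norm ?gauss_ge0// gauss_le1// ltW.
  - by move=> x; rewrite -[X in _ --> X]mulr1; apply: cvgMl_tmp; exact: gc.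
have fineE : fine (mu A) = fine (nu A).
  have h1 := lim mu; have h2 := lim nu.
  have e : (fun n => \int[mu]_x (\1_A x * gauss n.+1%:R^-1 0 x)) =
      (fun n => \int[nu]_x (\1_A x * gauss n.+1%:R^-1 0 x)).
    by apply/funext => n; rewrite e1.
  by rewrite e in h1; exact: cvg_unique h1 h2.
by rewrite -(fineK (fin_num_measure mu _ mA)) fineE fineK// fin_num_measure.
Qed.

End gauss_determining.

Lemma measurable_preimage d d' (T : measurableType d)
    (T' : measurableType d') (f : T -> T') A :
  measurable_fun setT f -> measurable A -> measurable (f @^-1` A).
Proof. by move=> mf mA; rewrite -[X in measurable X]setTI; exact: mf. Qed.

(** * The quadratic form at a perturbed difference *)

Section bilinear_sum.
Context {R : realType}.
Variables (n : nat) (G : nat -> nat -> R).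
Implicit Types a b c : nat -> R.

Definition bilinear_sum a b := \sum_(i < n) \sum_(j < n) a i * b j * G i j.

(** The form at [a - b + t c], expanded. Later [a] and [b] are the discretized laws of [X] and [Y],
    and [c] that of a point mass. *)
Lemma psd_bilinear_sum_ge0 a b c (t : R) : psd n G ->
  0 <= bilinear_sum a a + bilinear_sum b b - 2 * bilinear_sum a b +
    2 * t * (bilinear_sum a c - bilinear_sum b c) + t ^+ 2 * bilinear_sum c c.
Proof.
move=> [GC Gge0].
have DC f g : bilinear_sum f g = bilinear_sum g f.
  rewrite /bilinear_sum exchange_big/=; apply: eq_bigr => i _.
  by apply: eq_bigr => j _; rewrite [f _ * _]mulrC GC.
have Dl f g h k :
    bilinear_sum (fun i => f i + k * g i) h =
    bilinear_sum f h + k * bilinear_sum g h.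
  rewrite /bilinear_sum mulr_sumr -big_split; apply: eq_bigr => i _ /=.
  by rewrite mulr_sumr -big_split; apply: eq_bigr => j _ /=; ring.
have Dr f g h k :
    bilinear_sum h (fun i => f i + k * g i) =
    bilinear_sum h f + k * bilinear_sum h g by rewrite DC Dl DC (DC g).
have : 0 <= bilinear_sum (fun i => (a i + (-1) * b i) + t * c i)
    (fun i => (a i + (-1) * b i) + t * c i) by exact: Gge0.
rewrite (Dl _ c) !(Dr _ c) !(Dl a) !(Dr a) (DC b a) (DC c a) (DC c b).
by congr (_ <= _); ring.
Qed.

End bilinear_sum.

(** * Discretization by nearest points of a dense sequence *)

Section nearest_point.
Context {R : realType} {E : hilbertType R} (q : nat -> E).

Fixpoint nearest_dist n (x : E) : R :=
  if n is m.+1 then Num.min (nearest_dist m x) `|x - q m.+1| else `|x - q 0|.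

(** The strict comparison gives ties to the least index. Comparing with the running minimum makes
    measurability an induction on [n]. *)
Fixpoint nearest n (x : E) : nat :=
  if n is m.+1 then
    if `|x - q m.+1| < nearest_dist m x then m.+1 else nearest m x
  else 0.

Lemma nearest_le n x : (nearest n x <= n)%N.
Proof. by elim: n => //= n ih; case: ifP => // _; exact: leqW. Qed.

Lemma nearest_distE n x : `|x - q (nearest n x)| = nearest_dist n x.
Proof. by elim: n => //= n ih; case: ltP. Qed.

Lemma nearest_dist_le n k x : (k <= n)%N -> nearest_dist n x <= `|x - q k|.
Proof.
elim: n => [|n ih]; first by rewrite leqn0 => /eqP ->.
by rewrite leq_eqVlt ge_min => /predU1P[->|/ih ->//]; rewrite lexx orbT.
Qed.

(** Some [q k] lies within [e] of [x], and from index [k] on the nearest point is at least as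
    close. *)
Lemma cvg_nearest (dq : forall O, O !=set0 -> open O -> exists n, O (q n)) x :
  q (nearest n x) @[n --> \oo] --> x.
Proof.
apply/cvgrPdist_lt => e e0.
have [k] : exists k, ball x e (q k).
  by apply: dq; [exists x; exact: ballxx|exact: ball_open].
rewrite -ball_normE/= => xk; near=> n; rewrite nearest_distE.
apply: le_lt_trans xk; apply: nearest_dist_le.
by near: n; exact: nbhs_infty_ge.
Unshelve. all: by end_near. Qed.

Lemma measurable_dist (u : E) :
  measurable_fun setT ((fun x : E => `|x - u|) : borel E -> R).
Proof.
apply: continuous_borel_measurable => x.
by apply: cvg_norm; apply: cvgB; [exact: cvg_id|exact: cvg_cst].
Qed.

Lemma measurable_nearest_dist n :
  measurable_fun setT (nearest_dist n : borel E -> R).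
Proof.
elim: n => [|n ih]; first exact: measurable_dist.
by apply: measurable_minr => //; exact: measurable_dist.
Qed.

Lemma measurable_nearest n : measurable_fun setT (nearest n : borel E -> nat).
Proof.
elim: n => [|n ih]; first exact: measurable_cst.
apply: measurable_fun_ifT => //.
apply: measurable_fun_ltr; first exact: measurable_dist.
exact: measurable_nearest_dist.
Qed.

Lemma measurable_nearest_preimage n (A : set nat) :
  measurable (nearest n @^-1` A : set (borel E)).
Proof. exact: measurable_preimage (measurable_nearest n) _. Qed.

End nearest_point.

(** * Integrals over independent discrete pairs *)

Section independent_pairs.
Context {d : measure_display} {T : measurableType d} {R : realType}.
Variable P : probability T R.

Lemma Rintegral_sum n (f : 'I_n -> T -> R) :
  (forall i, bounded_measurable (f i)) ->
  bounded_measurable (fun w => \sum_(i < n) f i w) /\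
  \int[P]_w (\sum_(i < n) f i w) = \sum_(i < n) \int[P]_w f i w.
Proof.
elim: n f => [|n ih] f bf.
  rewrite big_ord0; under eq_Rintegral do rewrite big_ord0.
  rewrite Rintegral_cst// mul0r; split=> //.
  have := bounded_measurable_cst T (0 : R); congr bounded_measurable.
  by apply/funext => w; rewrite big_ord0.
have [bs es] := ih (fun i => f (lift ord0 i)) (fun i => bf _).
have fE w : \sum_(i < n.+1) f i w =
  1 * f ord0 w + \sum_(i < n) f (lift ord0 i) w by rewrite big_ord_recl mul1r.
split; first by rewrite (funext fE); exact: bounded_measurable_lin.
under eq_Rintegral do rewrite fE.
by rewrite Rintegral_lin// mul1r es big_ord_recl.
Qed.

Definition pairwise_independent d1 d2 (T1 : measurableType d1)
    (T2 : measurableType d2) (U : T -> T1) (V : T -> T2) :=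
  forall A B, measurable A -> measurable B ->
    P (U @^-1` A `&` V @^-1` B) = (P (U @^-1` A) * P (V @^-1` B))%E.

(** The integrand is a finite combination of indicators of the events [I = i], [J = j], whose
    probabilities factor by independence. *)
Lemma Rintegral_discrete n (I J : T -> nat) (F : nat -> nat -> R) :
  measurable_fun setT I -> measurable_fun setT J ->
  (forall w, (I w < n)%N) -> (forall w, (J w < n)%N) ->
  pairwise_independent I J ->
  measurable_fun setT (fun w => F (I w) (J w)) /\
  \int[P]_w F (I w) (J w) = \sum_(i < n) \sum_(j < n)
    fine (P (I @^-1` [set val i])) * fine (P (J @^-1` [set val j])) * F i j.
Proof.
move=> mI mJ In Jn IJ.
have mIi i : measurable (I @^-1` [set i]) by exact: measurable_preimage.
have mJj j : measurable (J @^-1` [set j]) by exact: measurable_preimage.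
have mIJ i j : measurable (I @^-1` [set i] `&` J @^-1` [set j]).
  exact: measurableI.
pose f i j w : R := F i j * \1_(I @^-1` [set i] `&` J @^-1` [set j]) w.
have bf i j : bounded_measurable (f i j).
  apply: bounded_measurableM; first exact: bounded_measurable_cst.
  exact: bounded_measurable_indic.
have FE : (fun w => F (I w) (J w)) =
    (fun w => \sum_(i < n) \sum_(j < n) f i j w).
  apply/funext => w; rewrite (bigD1 (Ordinal (In w)))//=.
  rewrite (bigD1 (Ordinal (Jn w)))//= !big1 ?addr0.
  - by rewrite /f indicE mem_set// mulr1.
  - move=> i /negP iI; apply: big1 => j _; rewrite /f indicE memNset ?mulr0//.
    by move=> /= [Ii _]; apply: iI; apply/eqP/val_inj.
  - move=> j /negP jJ; rewrite /f indicE memNset ?mulr0//.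
    by move=> /= [_ Jj]; apply: jJ; apply/eqP/val_inj.
have bs i := (Rintegral_sum (fun j : 'I_n => bf i j)).1.
have [[ms _] es] := Rintegral_sum (fun i : 'I_n => bs i).
split; first by rewrite FE.
have -> : \int[P]_w F (I w) (J w) =
    \int[P]_w (\sum_(i < n) \sum_(j < n) f i j w).
  by apply: eq_Rintegral => w _; exact: (congr1 (@^~ w) FE).
rewrite es; apply: eq_bigr => i _.
rewrite (Rintegral_sum (fun j : 'I_n => bf i j)).2; apply: eq_bigr => j _.
rewrite RintegralZl//; last first.
  by apply: bounded_measurable_integrable; exact: bounded_measurable_indic.
by rewrite Rintegral_indic// IJ// fineM ?fin_num_measure// mulrC.
Qed.

End independent_pairs.

(** * The energy identity forces equal Gaussian means *)

Section gauss_energy.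
Context {R : realType} {E : hilbertType R}.
Hypothesis sepE : separable E.
Context {d : measure_display} {T : measurableType d}.
Variable P : probability T R.
Implicit Types U V X Y : T -> borel E.
Variable s : R.
Hypothesis s0 : 0 < s.

Definition gauss_mean U V : R := \int[P]_w gauss s (U w) (V w).

(** Mass of the Voronoi cell of [q i] among [q 0], ..., [q n]; zero for [i > n]. *)
Definition index_law (q : nat -> E) n U i : R :=
  fine (P (U @^-1` (nearest q n @^-1` [set i]))).

(** The double sum is the mean for [U] and [V] moved to their nearest points; the integrands are
    bounded by 1 and converge by continuity. This carries positivity from finite matrices to
    laws. *)
Lemma gauss_mean_discretization (q : nat -> E) U V :
  (forall O, O !=set0 -> open O -> exists n, O (q n)) ->
  measurable_fun setT U -> measurable_fun setT V ->
  pairwise_independent P U V ->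
  \sum_(i < n.+1) \sum_(j < n.+1)
    index_law q n U i * index_law q n V j * gauss s (q i) (q j)
  @[n --> \oo] --> gauss_mean U V.
Proof.
move=> dq mU mV UV.
have [mF eF] : (forall n, measurable_fun setT
      (fun w => gauss s (q (nearest q n (U w))) (q (nearest q n (V w))))) /\
    (forall n, \int[P]_w gauss s (q (nearest q n (U w))) (q (nearest q n (V w)))
      = \sum_(i < n.+1) \sum_(j < n.+1)
        index_law q n U i * index_law q n V j * gauss s (q i) (q j)).
  apply/all_and2 => n.
  apply: (@Rintegral_discrete _ _ _ P n.+1 (nearest q n \o U) (nearest q n \o V)
    (fun i j => gauss s (q i) (q j))).
  - exact: measurableT_comp (measurable_nearest q n) mU.
  - exact: measurableT_comp (measurable_nearest q n) mV.
  - by move=> w; rewrite ltnS nearest_le.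
  - by move=> w; rewrite ltnS nearest_le.
  - move=> A B _ _; have mA := measurable_nearest_preimage q n A.
    by have := UV _ _ mA (measurable_nearest_preimage q n B).
rewrite -(funext eF).
apply: (@Rintegral_bounded_cvg _ _ _ P _ _ 1 mF) => [n w|w].
  by rewrite ger0_norm ?gauss_ge0// gauss_le1// ltW.
apply: continuous_cvg; first exact: continuous_expR.
apply: cvgN; apply: cvgMl_tmp; apply: (@cvg_comp _ _ _
  (fun n => `|q (nearest q n (V w)) - q (nearest q n (U w))|)
  (fun a => a ^+ 2)).
  by apply: cvg_norm; apply: cvgB; exact: cvg_nearest.
exact: exprn_continuous.
Qed.

(** In the limit, the form at law(X) - law(Y) plus [t] times the point mass at [u] loses its
    constant term by the energy identity. What remains, [2 * t * b + t ^+ 2] with [b] the difference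
    of the two means, is nonnegative for all [t] only if [b = 0]. *)
Lemma eq_gauss_mean X X' Y Y' :
  measurable_fun setT X -> measurable_fun setT X' ->
  measurable_fun setT Y -> measurable_fun setT Y' ->
  pairwise_independent P X X' -> pairwise_independent P Y Y' ->
  pairwise_independent P X Y -> eq_in_law P X' X -> eq_in_law P Y' Y ->
  2 * gauss_mean X Y = gauss_mean X X' + gauss_mean Y Y' ->
  forall u : E, gauss_mean X (fun=> u) = gauss_mean Y (fun=> u).
Proof.
move=> mX mX' mY mY' XX' YY' XY lX lY eXY u.
have [q dq] := separable_seq sepE.
pose Z : T -> borel E := fun=> u.
have mZ : measurable_fun setT Z by exact: measurable_cst.
(* A constant is independent of every random element, itself included, so the terms with [Z] also
   have limits. *)
have indZ V : pairwise_independent P V Z.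
  move=> A B mA mB; rewrite (_ : Z @^-1` B = if u \in B then setT else set0).
    case: ifP => _; first by rewrite setIT probability_setT mule1.
    by rewrite setI0 measure0 mule0.
  rewrite /Z; apply/seteqP; split=> w /=; case: ifPn => //.
    by rewrite notin_setE.
  by rewrite inE.
have ZZ : gauss_mean Z Z = 1.
  rewrite /gauss_mean; under eq_Rintegral do rewrite gaussxx.
  rewrite Rintegral_cst; last exact: measurableT.
  by rewrite mul1r; exact: (congr1 fine (@probability_setT _ _ _ P)).
have psd_ge0 t : 0 <= 2 * t * (gauss_mean X Z - gauss_mean Y Z) + t ^+ 2.
  (* The discretized form sees only marginal laws, so its value at the pair [X], [X] converges to
     the mean over the independent copies [X], [X']. *)
  have lX' n : index_law q n X' = index_law q n X.
    apply/funext => i.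
    by rewrite /index_law (lX _ (measurable_nearest_preimage q n _)).
  have lY' n : index_law q n Y' = index_law q n Y.
    apply/funext => i.
    by rewrite /index_law (lY _ (measurable_nearest_preimage q n _)).
  pose D n U V := bilinear_sum n.+1 (fun i j => gauss s (q i) (q j))
    (index_law q n U) (index_law q n V).
  have c U V : measurable_fun setT U -> measurable_fun setT V ->
      pairwise_independent P U V -> D n U V @[n --> \oo] --> gauss_mean U V.
    exact: gauss_mean_discretization.
  have := c _ _ mX mX' XX'; have := c _ _ mY mY' YY'.
  rewrite /D; under eq_fun do rewrite lY'; rewrite -/(D _ Y Y).
  move=> cY; under eq_fun do rewrite lX'; rewrite -/(D _ X X) => cX.
  have lim : D n X X + D n Y Y - 2 * D n X Y + 2 * t * (D n X Z - D n Y Z) +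
      t ^+ 2 * D n Z Z @[n --> \oo] -->
      gauss_mean X X' + gauss_mean Y Y' - 2 * gauss_mean X Y +
      2 * t * (gauss_mean X Z - gauss_mean Y Z) + t ^+ 2 * gauss_mean Z Z.
    apply: cvgD; last by apply: cvgMl_tmp; exact: c.
    apply: cvgD; last by apply: cvgMl_tmp; apply: cvgB; exact: c.
    by apply: cvgB; [exact: cvgD|apply: cvgMl_tmp; exact: c].
  rewrite -eXY subrr add0r ZZ mulr1 in lim.
  apply: (cvgr_to_ge lim); apply: nearW => n.
  exact: psd_bilinear_sum_ge0 (gauss_psd _ _ (ltW s0)).
set b := gauss_mean X Z - gauss_mean Y Z in psd_ge0.
apply/eqP; rewrite -subr_eq0 -/Z -/b; apply/eqP; clearbody b.
(* At [t = - b] the bound reads [0 <= - b ^+ 2]. *)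
have := psd_ge0 (- b); rewrite (_ : _ + _ = - b ^+ 2); last by ring.
by rewrite oppr_ge0 => b2; apply/eqP; rewrite -sqrf_eq0 eq_le b2 sqr_ge0.
Qed.

End gauss_energy.

(** * Laws of random elements, of pairs and of distances *)

Section laws.
Context {d : measure_display} {T : measurableType d} {R : realType}.
Variable P : probability T R.

Lemma restricted_law_measure d' (T' : measurableType d') (f : T -> T') B :
  measurable_fun setT f -> measurable B ->
  exists m : {measure set T' -> \bar R},
    forall A, m A = P (B `&` f @^-1` A).
Proof.
move=> mf mB; unshelve eexists; first exact: (pushforward (mrestr P mB) f).
by move=> A; rewrite setIC.
Qed.

Lemma law_measure d' (T' : measurableType d') (f : T -> T') :
  measurable_fun setT f ->
  exists m : {measure set T' -> \bar R}, (forall A, m A = P (f @^-1` A)) /\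
    forall h : T' -> \bar R,
      measurable_fun setT h -> (forall x, (0 <= h x)%E) ->
      (\int[m]_x h x = \int[P]_w h (f w))%E.
Proof.
move=> mf; unshelve eexists; first exact: (pushforward P f).
split=> // h mh h0.
by rewrite (ge0_integral_pushforward mf).
Qed.

(** Rectangles are stable under intersection and generate the product sigma-algebra; uniqueness of
    finite measures applies. *)
Lemma eq_measure_rectangles d1 d2 (T1 : measurableType d1)
    (T2 : measurableType d2) (m1 m2 : {measure set (T1 * T2) -> \bar R}) :
  (m1 setT < +oo)%E ->
  (forall A B, measurable A -> measurable B -> m1 (A `*` B) = m2 (A `*` B)) ->
  forall C, measurable C -> m1 C = m2 C.
Proof.
move=> m1oo m12 C mC.
apply: (measure_unique [set A `*` B | A in measurable & B in measurable]
  (fun=> setT)) mC => //.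
- exact: measurable_prod_measurableType.
- move=> _ _ [A mA [B mB <-]] [A' mA' [B' mB' <-]].
  exists (A `&` A'); first exact: measurableI.
  by exists (B `&` B'); [exact: measurableI|rewrite setXI].
- by move=> _; exists setT => //; exists setT => //; rewrite setXTT.
- by rewrite bigcup_const//; exists 0.
- by move=> _ [A mA [B mB <-]]; exact: m12.
Qed.

(** Serves two purposes: with [B] an event of the coins and [c] its probability it factors [B] out;
    with [B = setT] and [c = 1] it compares the laws of two pairs. *)
Lemma eq_pair_law d1 d2 (T1 : measurableType d1) (T2 : measurableType d2)
    (U U' : T -> T1) (V V' : T -> T2) (B : set T) (c : {nonneg R}) :
  measurable_fun setT U -> measurable_fun setT V ->
  measurable_fun setT U' -> measurable_fun setT V' -> measurable B ->
  (forall A1 A2, measurable A1 -> measurable A2 ->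
    P (B `&` (U @^-1` A1 `&` V @^-1` A2)) =
    (c%:num%:E * P (U' @^-1` A1 `&` V' @^-1` A2))%E) ->
  forall C : set (T1 * T2), measurable C ->
    P (B `&` (fun w => (U w, V w)) @^-1` C) =
    (c%:num%:E * P ((fun w => (U' w, V' w)) @^-1` C))%E.
Proof.
move=> mU mV mU' mV' mB h C mC.
have [m1 m1E] := restricted_law_measure (measurable_fun_pair mU mV) mB.
have [m2 [m2E _]] := law_measure (measurable_fun_pair mU' mV').
rewrite -m1E -m2E.
apply: (@eq_measure_rectangles _ _ _ _ m1 (mscale c m2)) => //.
  rewrite m1E; apply: (le_lt_trans (probability_le1 _ _)); last exact: ltry.
  apply: measurableI => //; apply: measurable_preimage => //.
  exact: measurable_fun_pair.
move=> A1 A2 mA1 mA2; rewrite m1E; apply: etrans (h _ _ mA1 mA2) _.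
by congr (_ * _)%E; rewrite [RHS]m2E.
Qed.

(** The two values have total probability 1, so other values of [X] occur only on a null event. *)
Lemma split_fair (X : {RV P >-> R}) (G : set T) : fair_01 P X -> measurable G ->
  (P G = P (X @^-1` [set 1%R] `&` G) + P (X @^-1` [set 0%R] `&` G))%E.
Proof.
move=> [X0 X1] mG.
have m0 : measurable (X @^-1` [set 0]) by exact: measurable_preimage.
have m1 : measurable (X @^-1` [set 1]) by exact: measurable_preimage.
have d01 : X @^-1` [set 1] `&` X @^-1` [set 0] = set0.
  by apply/seteqP; split=> // w [/= -> /eqP]; rewrite oner_eq0.
rewrite -measureU//; [|exact: measurableI|exact: measurableI|]; last first.
  by rewrite setIACA d01 set0I.
rewrite -setIUl; set D := _ `|` _.
have mD : measurable D by exact: measurableU.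
have PD : P (~` D) = 0%E.
  have PD1 : P D = 1%E.
    apply: etrans (measureU _ m1 m0 d01) (etrans (congr2 adde X1 X0) _).
    by apply: (congr1 EFin (_ : 2^-1 + 2^-1 = 1 :> R)); field.
  by rewrite probability_setC// PD1 subee.
rewrite -{1}(setIT G) -(setUv D) setIUr measureU//.
- rewrite (setIC G D) [X in (_ + X)%E](_ : _ = 0%E) ?adde0//.
  apply: subset_measure0 PD => //; last exact: measurableC.
  by apply: measurableI => //; exact: measurableC.
- exact: measurableI.
- by apply: measurableI => //; exact: measurableC.
- by rewrite setIACA setICr setI0.
Qed.

End laws.

(** The domain carries the product of two Borel sigma-algebras, so continuity alone is not enough.
    By density, the distance is below [r] exactly when the path through some [q k] is shorter than
    [r], a countable union. *)
Lemma measurable_dist_pair (R : realType) (E : hilbertType R) :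
  separable E ->
  measurable_fun setT
    (fun p : borel E * borel E => `|(p.1 : E) - (p.2 : E)| : R).
Proof.
move=> sepE; have [q dq] := separable_seq sepE.
apply: (measurability _ (RGenInftyO.measurableE R)) => _ [_ [r ->] <-].
pose h k (p : borel E * borel E) : R :=
  `|(p.1 : E) - q k| + `|(p.2 : E) - q k|.
have -> : setT `&` (fun p : borel E * borel E => `|(p.1 : E) - (p.2 : E)|)
    @^-1` `]-oo, r[%classic = \bigcup_k (h k @^-1` `]-oo, r[%classic).
  rewrite setTI; apply/seteqP; split=> -[x y] /=; rewrite in_itv/=.
    (* The detour through a point within [e] of [x] costs less than [2 * e], which is the slack. *)
    move=> xyr; pose e := (r - `|(x : E) - y|) / 2.
    have e0 : 0 < e by rewrite divr_gt0// subr_gt0.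
    have [k] : exists k, ball (x : E) e (q k).
      by apply: dq; [exists x; exact: ballxx|exact: ball_open].
    rewrite -ball_normE/= => xk; exists k => //=; rewrite in_itv/= /h/=.
    have : `|(y : E) - q k| <= `|(x : E) - y| + `|(x : E) - q k|.
      by rewrite (distrC x y) -[in leLHS](subrKA (x : E)) ler_normD.
    by rewrite /e in xk; lra.
  move=> [k _]; rewrite /h/= in_itv/=; apply: le_lt_trans.
  by rewrite -(subrKA (q k)) (distrC y) ler_normD.
apply: bigcupT_measurable => k; rewrite -[X in measurable X]setTI.
have mh : measurable_fun setT (h k).
  apply: measurable_funD.
    exact: measurableT_comp (measurable_dist (q k)) (measurable_fst).
  exact: measurableT_comp (measurable_dist (q k)) (measurable_snd).
by apply: mh => //; exact: measurable_itv.
Qed.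

(** The product rule at the full index set; [setT] in some slots yields the rule for any
    subfamily. *)
Lemma mutually_independent6 (d d' : measure_display) (T : measurableType d)
    (T' : measurableType d') (R : realType) (P : probability T R)
    (X X' Y Y' : {RV P >-> T'}) (eps del : {RV P >-> R}) :
  mutually_independent P
    (tnth [tuple sigma_of X; sigma_of X'; sigma_of Y; sigma_of Y';
                 sigma_of eps; sigma_of del]) ->
  forall A1 A2 A3 A4 A5 A6, measurable A1 -> measurable A2 -> measurable A3 ->
    measurable A4 -> measurable A5 -> measurable A6 ->
  (P (X @^-1` A1 `&` X' @^-1` A2 `&` Y @^-1` A3 `&` Y' @^-1` A4 `&`
    eps @^-1` A5 `&` del @^-1` A6) =
  P (X @^-1` A1) * P (X' @^-1` A2) * P (Y @^-1` A3) * P (Y' @^-1` A4) *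
  P (eps @^-1` A5) * P (del @^-1` A6))%E.
Proof.
move=> indep A1 A2 A3 A4 A5 A6 m1 m2 m3 m4 m5 m6.
pose A := tnth [tuple X @^-1` A1; X' @^-1` A2; Y @^-1` A3; Y' @^-1` A4;
  eps @^-1` A5; del @^-1` A6].
have := indep [set: 'I_6]%SET A.
have hA (i : 'I_6) : i \in [set: 'I_6]%SET -> tnth [tuple sigma_of X;
    sigma_of X'; sigma_of Y; sigma_of Y'; sigma_of eps; sigma_of del] i (A i).
  move=> _; rewrite /A !(tnth_nth set0); case: i => -[|[|[|[|[|[|//]]]]]] _ /=;
    [exists A1|exists A2|exists A3|exists A4|exists A5|exists A6] => //;
    by rewrite setTI.
move=> /(_ hA); rewrite (eq_bigl xpredT); last by move=> i; rewrite finset.inE.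
rewrite !big_ord_recr big_ord0 /= mul1e /A !(tnth_nth set0) /= => <-.
congr (P _); apply/seteqP; split=> w /=.
  move=> [[[[[h1 h2] h3] h4] h5] h6] i _.
  by rewrite (tnth_nth set0); case: i => -[|[|[|[|[|[|//]]]]]] i6.
move=> h; have h' (i : 'I_6) := h i (finset.in_setT i).
have := (h' (inord 0), h' (inord 1), h' (inord 2), h' (inord 3), h' (inord 4),
  h' (inord 5)); rewrite !(tnth_nth set0) !inordK//=.
by case=> -[[[[]]]].
Qed.

Lemma preimage_opprK (V : zmodType) (A : set V) :
  -%R @^-1` (-%R @^-1` A) = A.
Proof. by apply/seteqP; split=> x /=; rewrite opprK. Qed.

(** * The law of [S] as a mixture of laws of distances *)

Section mixture.
Context {R : realType} {E : hilbertType R}.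
Hypothesis sepE : separable E.
Context {d : measure_display} {T : measurableType d}.
Variable P : probability T R.
Variables (X X' Y Y' : {RV P >-> borel E}) (eps del : {RV P >-> R}).
Hypothesis indep : mutually_independent P
  (tnth [tuple sigma_of X; sigma_of X'; sigma_of Y; sigma_of Y';
               sigma_of eps; sigma_of del]).
Hypothesis fair_eps : fair_01 P eps.
Hypothesis fair_del : fair_01 P del.

Let dist (U V : T -> borel E) w : R := `|(U w : E) - (V w : E)|.

Let mdist (U V : {RV P >-> borel E}) : measurable_fun setT (dist U V).
Proof.
exact: (measurableT_comp (measurable_dist_pair sepE)
  (measurable_fun_pair (measurable_funPT U) (measurable_funPT V))).
Qed.

Let S w : R := del w * dist X Y w -
  (1 - del w) * (eps w * dist X X' w + (1 - eps w) * dist Y Y' w).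

Let mS : measurable_fun setT S.
Proof.
have mdel := measurable_funPT del; have meps := measurable_funPT eps.
have monem (f : T -> R) :
    measurable_fun setT f -> measurable_fun setT (fun w => 1 - f w).
  by move=> mf; apply: measurable_funB.
apply: measurable_funB; first exact: measurable_funM mdel (mdist X Y).
apply: (measurable_funM (monem _ mdel)); apply: measurable_funD.
  exact: measurable_funM meps (mdist X X').
exact: measurable_funM (monem _ meps) (mdist Y Y').
Qed.

Let PT := @probability_setT _ _ _ P.

Lemma indepXY : pairwise_independent P X Y.
Proof.
move=> A B mA mB.
have := mutually_independent6 indep mA measurableT mB measurableT measurableT
  measurableT.
by rewrite !preimage_setT !setIT !PT !mule1.
Qed.

Lemma indepXX' : pairwise_independent P X X'.
Proof.
move=> A B mA mB.
have := mutually_independent6 indep mA mB measurableT measurableT measurableT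
  measurableT.
by rewrite !preimage_setT !setIT !PT !mule1.
Qed.

Lemma indepYY' : pairwise_independent P Y Y'.
Proof.
move=> A B mA mB.
have := mutually_independent6 indep measurableT measurableT mA mB measurableT
  measurableT.
by rewrite !preimage_setT !setIT !setTI !PT !mule1 !mul1e.
Qed.

(** Real-valued, so that the mixture identities become linear arithmetic over [R]. *)
Let law (f : T -> R) A : R := fine (P (f @^-1` A)).

Let lawE f A : measurable_fun setT f -> measurable A ->
  P (f @^-1` A) = (law f A)%:E.
Proof.
by move=> mf mA; rewrite fineK// fin_num_measure//; exact: measurable_preimage.
Qed.

Let restricted_dist_law (U V : {RV P >-> borel E}) (B : set T) (c : {nonneg R})
    (A : set R) :
  measurable A -> measurable B ->
  (forall A1 A2, measurable A1 -> measurable A2 ->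
    P (B `&` (U @^-1` A1 `&` V @^-1` A2)) =
    (c%:num%:E * P (U @^-1` A1 `&` V @^-1` A2))%E) ->
  P (B `&` dist U V @^-1` A) = (c%:num * law (dist U V) A)%:E.
Proof.
move=> mA mB h; rewrite EFinM -(lawE (mdist U V) mA).
have mC := measurable_preimage (measurable_dist_pair sepE) mA.
exact: (eq_pair_law (measurable_funPT U) (measurable_funPT V)
  (measurable_funPT U) (measurable_funPT V) mB h mC).
Qed.

(** Splitting along the coins: [S] is a distance when [del = 1], and minus a distance when
    [del = 0], that of [X], [X'] or of [Y], [Y'] according to [eps]. *)
Let mixture_law A : measurable A ->
  law S A = 2^-1 * law (dist X Y) A +
    4^-1 * (law (dist X X') (-%R @^-1` A) + law (dist Y Y') (-%R @^-1` A)).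
Proof.
move=> mA; apply: (@EFin_inj R); rewrite -(lawE mS mA).
have mSA := measurable_preimage mS mA.
have mNA : measurable (-%R @^-1` A : set R).
  by apply: measurable_preimage => //; exact: oppr_measurable.
have m1 (f : {RV P >-> R}) v : measurable (f @^-1` [set v]).
  exact: measurable_preimage.
rewrite (split_fair fair_del mSA) EFinD; congr (_ + _)%E.
  have -> : del @^-1` [set 1] `&` S @^-1` A =
      del @^-1` [set 1] `&` dist X Y @^-1` A.
    by apply/seteqP; split=> w /= [del1];
      rewrite /S del1 mul1r subrr mul0r subr0.
  apply: (@restricted_dist_law X Y _ (2^-1)%:nng) => // A1 A2 mA1 mA2.
  have := mutually_independent6 indep mA1 measurableT mA2 measurableT
    measurableT (measurable_set1 1).
  rewrite !preimage_setT !setIT !PT !mule1 indepXY// => h.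
  by rewrite setIC h fair_del.2 muleC.
rewrite (split_fair fair_eps); last exact: measurableI.
rewrite mulrDr EFinD; congr (_ + _)%E.
  have -> : eps @^-1` [set 1] `&` (del @^-1` [set 0] `&` S @^-1` A) =
      (eps @^-1` [set 1] `&` del @^-1` [set 0]) `&`
      dist X X' @^-1` (-%R @^-1` A).
    rewrite setIA; apply/seteqP.
    split=> w /= [[eps1 del0]]; rewrite /S del0 eps1 mul0r sub0r subr0 !mul1r;
      by rewrite subrr mul0r addr0.
  apply: (@restricted_dist_law X X' _ (4^-1)%:nng) => // [|A1 A2 mA1 mA2].
    exact: measurableI.
  have := mutually_independent6 indep mA1 mA2 measurableT measurableT
    (measurable_set1 1) (measurable_set1 0).
  rewrite !preimage_setT !setIT !PT !mule1 indepXX'// => h.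
  rewrite setIC setIA h fair_del.1 fair_eps.2 -muleA muleC -EFinM.
  by congr (_%:E * _)%E; rewrite /=; field.
have -> : eps @^-1` [set 0] `&` (del @^-1` [set 0] `&` S @^-1` A) =
    (eps @^-1` [set 0] `&` del @^-1` [set 0]) `&`
    dist Y Y' @^-1` (-%R @^-1` A).
  rewrite setIA; apply/seteqP.
  split=> w /= [[eps1 del0]]; rewrite /S del0 eps1 !mul0r sub0r subr0 !mul1r;
    by rewrite add0r.
apply: (@restricted_dist_law Y Y' _ (4^-1)%:nng) => // [|A1 A2 mA1 mA2].
  exact: measurableI.
have := mutually_independent6 indep measurableT measurableT mA1 mA2
  (measurable_set1 0) (measurable_set1 0).
rewrite !preimage_setT !setTI !PT !mul1e indepYY'// => h.
rewrite setIC setIA h fair_del.1 fair_eps.1 -muleA muleC -EFinM.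
by congr (_%:E * _)%E; rewrite /=; field.
Qed.

Hypothesis lawX' : eq_in_law P X' X.
Hypothesis lawY' : eq_in_law P Y' Y.

(** All three distances then have one law, and the mixture gives [A] and its reflection equal weight
    1/2. *)
Lemma symmetric_mixture : eq_in_law P X Y -> eq_in_law P S (fun w => - S w).
Proof.
move=> XY A mA.
have eq_dist (U V U' V' : {RV P >-> borel E}) B :
    pairwise_independent P U V -> pairwise_independent P U' V' ->
    eq_in_law P U U' -> eq_in_law P V V' -> measurable B ->
    law (dist U V) B = law (dist U' V') B.
  move=> UV UV' UU' VV' mB; apply: (@EFin_inj R).
  rewrite -(lawE (mdist U V) mB) -(lawE (mdist U' V') mB).
  have mC := measurable_preimage (measurable_dist_pair sepE) mB.
  have h A1 A2 : measurable A1 -> measurable A2 ->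
      P (setT `&` (U @^-1` A1 `&` V @^-1` A2)) =
      ((1%:nng : {nonneg R})%:num%:E * P (U' @^-1` A1 `&` V' @^-1` A2))%E.
    by move=> mA1 mA2; rewrite setTI mul1e UV// UV'// UU'// VV'.
  have := eq_pair_law (measurable_funPT U) (measurable_funPT V)
    (measurable_funPT U') (measurable_funPT V') measurableT h mC.
  by rewrite setTI mul1e.
have mNA : measurable (-%R @^-1` A : set R).
  by apply: measurable_preimage => //; exact: oppr_measurable.
rewrite [RHS](_ : _ = P (S @^-1` (-%R @^-1` A)))//.
rewrite (lawE mS mA) (lawE mS mNA) !mixture_law//.
have XX' B : measurable B -> law (dist X X') B = law (dist X Y) B.
  move=> mB; apply: (eq_dist _ _ _ _ _ indepXX' indepXY) => // C mC.
  by rewrite lawX'// XY.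
have YY' B : measurable B -> law (dist Y Y') B = law (dist X Y) B.
  move=> mB; apply: (eq_dist _ _ _ _ _ indepYY' indepXY) => // C mC.
  by rewrite XY.
by rewrite preimage_opprK !XX'// !YY'//; congr EFin; field.
Qed.

(** Positive values of [S] come from the distance of [X] and [Y], negative ones from the other two;
    symmetry equates the two halves away from 0. *)
Let mixture_dist_law A : eq_in_law P S (fun w => - S w) -> measurable A ->
  2 * law (dist X Y) A = law (dist X X') A + law (dist Y Y') A.
Proof.
move=> symS.
(* Symmetry says nothing about the mass at 0; it is recovered from the total mass by passing to the
   complement. *)
suff pos (B : set R) : measurable B -> ~ B 0 ->
    2 * law (dist X Y) B = law (dist X X') B + law (dist Y Y') B.
  move=> mA; have [A0|A0] := pselect (A 0); last exact: pos.
  have lawC (U V : {RV P >-> borel E}) :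
      law (dist U V) (~` A) = 1 - law (dist U V) A.
    apply: (@EFin_inj R); rewrite EFinB.
    rewrite -(lawE (mdist U V) (measurableC mA)) -(lawE (mdist U V) mA).
    rewrite preimage_setC probability_setC//.
    exact: measurable_preimage (mdist U V) mA.
  have := pos _ (measurableC mA) (fun h => h A0); rewrite !lawC; lra.
(* Distances that avoid 0 are positive, so [B'] has the same mass as [B] and its reflection has mass
   0. *)
move=> mB B0; pose B' := B `&` [set t | 0 < t].
have mB' : measurable B'.
  apply: measurableI => //; rewrite -set_itvoy; exact: measurable_itv.
have lawB' U V : law (dist U V) B' = law (dist U V) B.
  rewrite /law (_ : dist U V @^-1` B' = dist U V @^-1` B)//.
  apply/seteqP; split=> w /=; first by case.
  move=> Bw; split=> //=.
  rewrite lt_neqAle normr_ge0 andbT; apply/eqP => e; apply: B0.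
  by rewrite e.
have lawN U V : law (dist U V) (-%R @^-1` B') = 0.
  rewrite /law (_ : _ @^-1` _ = set0) ?measure0//.
  by apply/seteqP; split=> // w /= [_]; rewrite /= oppr_gt0 ltNge normr_ge0.
have mNB' : measurable (-%R @^-1` B' : set R).
  by apply: measurable_preimage => //; exact: oppr_measurable.
have : law S B' = law S (-%R @^-1` B') by rewrite /law (symS _ mB').
rewrite !mixture_law// preimage_opprK !lawN !lawB'; lra.
Qed.

(** The Gaussian kernel is a function [phi] of the distance, so integrating [phi] against the
    identity of laws gives the energy identity. The factor 2 is encoded as the measure [m1 + m1]. *)
Lemma symmetric_mixture_gauss_mean (s : R) : 0 < s ->
  eq_in_law P S (fun w => - S w) ->
  2 * gauss_mean P s X Y = gauss_mean P s X X' + gauss_mean P s Y Y'.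
Proof.
move=> s0 symS; pose phi t : R := expR (- (s * t ^+ 2)).
have phi_ge0 t : (0 <= (phi t)%:E)%E by rewrite lee_fin expR_ge0.
have cphi : continuous phi.
  move=> t; apply: continuous_comp; last exact: continuous_expR.
  by apply: cvgN; apply: cvgMl_tmp; exact: exprn_continuous.
have mphi : measurable_fun setT phi by exact: continuous_measurable_fun.
have mphiE : measurable_fun setT (EFin \o phi) by exact/measurable_EFinP.
have intE (U V : {RV P >-> borel E}) :
    (\int[P]_w (phi (dist U V w))%:E = (gauss_mean P s U V)%:E)%E.
  have e w : gauss s (U w) (V w) = phi (dist U V w) by rewrite gaussC.
  rewrite /gauss_mean; under eq_Rintegral do rewrite e.
  rewrite fineK//; apply: integrable_fin_num => //.
  apply: bounded_measurable_integrable; split.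
    exact: measurableT_comp mphi (mdist U V).
  by exists 1 => w; rewrite -e ger0_norm ?gauss_ge0// gauss_le1// ltW.
have [m1 [m1E m1I]] := law_measure P (mdist X Y).
have [m2 [m2E m2I]] := law_measure P (mdist X X').
have [m3 [m3E m3I]] := law_measure P (mdist Y Y').
have eq_m A : measurable A -> measure_add m1 m1 A = measure_add m2 m3 A.
  move=> mA; rewrite !measure_addE m1E m2E m3E.
  rewrite (lawE (mdist X Y) mA) (lawE (mdist X X') mA) (lawE (mdist Y Y') mA).
  by rewrite -!EFinD -(mixture_dist_law symS mA); congr EFin; ring.
have : (\int[measure_add m1 m1]_t (phi t)%:E =
    \int[measure_add m2 m3]_t (phi t)%:E)%E.
  by apply: eq_measure_integral => A mA _; exact: eq_m.
rewrite !ge0_integral_measure_add//.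
rewrite !(m1I _ mphiE phi_ge0) (m2I _ mphiE phi_ge0) (m3I _ mphiE phi_ge0) /=.
rewrite !intE -!EFinD.
by move=> /(@EFin_inj R) <-; ring.
Qed.

End mixture.

(** * Equality in law is equivalent to symmetry of the mixture *)

Theorem theorem1p1 (R : realType) (E : hilbertType R) (sepE : separable E)
    (d : measure_display) (T : measurableType d) (P : probability T R)
    (X X' Y Y' : {RV P >-> borel E}) (eps del : {RV P >-> R})
    (indep : mutually_independent P
       (tnth [tuple sigma_of X; sigma_of X'; sigma_of Y; sigma_of Y';
                    sigma_of eps; sigma_of del]))
    (lawX' : eq_in_law P X' X) (lawY' : eq_in_law P Y' Y)
    (fair_eps : fair_01 P eps) (fair_del : fair_01 P del) :
  let S : T -> R := fun w =>
    del w * `|(X w : E) - (Y w : E)|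
    - (1 - del w) * (eps w * `|(X w : E) - (X' w : E)|
                     + (1 - eps w) * `|(Y w : E) - (Y' w : E)|) in
  eq_in_law P X Y <-> eq_in_law P S (fun w => - S w).
Proof.
move=> S; split; first exact: symmetric_mixture.
move=> symS A mA.
rewrite -[LHS]/(distribution P X A) -[RHS]/(distribution P Y A).
apply: gauss_determining => //.
move=> s u s0.
(* An integral against a law is a Gaussian mean with constant second argument, the form in which the
   energy argument delivers equality. *)
have distr (U : {RV P >-> borel E}) :
    \int[distribution P U]_x gauss s u x = gauss_mean P s U (fun=> u).
  rewrite /gauss_mean /Rintegral ge0_integral_distribution//.
  - by congr fine; apply: eq_integral => w _ /=; rewrite gaussC.
  - by apply/measurable_EFinP; exact: (bounded_measurable_gauss u s0).1.
  - by move=> x; rewrite lee_fin gauss_ge0.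
rewrite !distr; apply: (eq_gauss_mean sepE s0 _ _ _ _ _ _ _ lawX' lawY') => //.
- exact: indepXX' indep.
- exact: indepYY' indep.
- exact: indepXY indep.
- exact: (symmetric_mixture_gauss_mean sepE indep).
Qed.
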